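(* Let $(W,S)$ be a Coxeter system with $S$ finite, and let $\mathcal{S}$ be the set of all spherical subsets of $S$. Then $$\sum_{T\in\mathcal{S}}\frac{(-1)^{|T|}}{W_T(t)}=\frac{1}{W(t^{-1})},$$ as an identity in the field $\mathbb{Q}((t^{-1}))$ of formal Laurent series in $t^{-1}$.
   Context: A Coxeter system $(W,S)$: $W$ is the group generated by the finite set $S$ subject to the relations $(st)^{m_{st}}=1$ for $s,t\in S$, where $m_{ss}=1$ and, for $s\neq t$, $m_{st}=m_{ts}\in\{2,3,\ldots,\infty\}$ ($m_{st}=\infty$ means no relation). For $w\in W$, $\ell(w)$ denotes the word length of $w$ with respect to $S$. For $T\subseteq S$, $W_T$ is the subgroup of $W$ generated by $T$ (so $W_\emptyset=\{1\}$ and $W_S=W$); it is a Coxeter group with generating set $T$, and its word length with respect to $T$ is the restriction of $\ell$. A subset $T\subseteq S$ is called spherical if $W_T$ is finite (the empty set is spherical). The growth series of $W$ is the formal power series $W(t)=\sum_{w\in W}t^{\ell(w)}$, and $W(t^{-1})=\sum_{w\in W}t^{-\ell(w)}$ is the corresponding formal power series in $t^{-1}$. For spherical $T$, $W_T(t)=\sum_{w\in W_T}t^{\ell(w)}$ is a nonzero polynomial in $t$, regarded as an invertible element of $\mathbb{Q}((t^{-1}))$. *)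

(* Defs.v *)
From HB Require Import structures.
From mathcomp Require Import all_boot all_order all_algebra.
From mathcomp Require Import finmap boolp classical_sets functions cardinality fsbigop.

Set Implicit Arguments.
Unset Strict Implicit.
Unset Printing Implicit Defensive.

Import GRing.Theory.
Local Open Scope ring_scope.

(* A wrapper is needed because the bare function type nat -> R already has    *)
(* the pointwise product.                                                     *)
Record fps (R : Type) := Fps { fpscoef :> nat -> R }.

HB.instance Definition _ (R : Type) := [isNew for @fpscoef R].
HB.instance Definition _ (R : Type) := gen_eqMixin (fps R).
HB.instance Definition _ (R : Type) := gen_choiceMixin (fps R).

Lemma fpsP (R : Type) (f g : fps R) : (forall n, f n = g n) -> f = g.
Proof. by case: f g => [f] [g] /= /funext ->. Qed.

Section FpsRing.
Variable R : comNzRingType.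
Implicit Types f g h : fps R.

Definition fps0 : fps R := Fps (fun=> 0).
Definition fps_opp f := Fps (fun n => - f n).
Definition fps_add f g := Fps (fun n => f n + g n).
Definition fps1 : fps R := Fps (fun n => (n == 0%N)%:R).
Definition fps_mul f g := Fps (fun n => \sum_(i < n.+1) f i * g (n - i)%N).

Fact fps_addA : associative fps_add.
Proof. by move=> f g h; apply: fpsP => n /=; rewrite addrA. Qed.
Fact fps_addC : commutative fps_add.
Proof. by move=> f g; apply: fpsP => n /=; rewrite addrC. Qed.
Fact fps_add0 : left_id fps0 fps_add.
Proof. by move=> f; apply: fpsP => n /=; rewrite add0r. Qed.
Fact fps_addN : left_inverse fps0 fps_opp fps_add.
Proof. by move=> f; apply: fpsP => n /=; rewrite addNr. Qed.

HB.instance Definition _ :=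
  GRing.isZmodule.Build (fps R) fps_addA fps_addC fps_add0 fps_addN.

Definition fps_trunc n f : {poly R} := \poly_(i < n.+1) f i.

Lemma coef_fps_trunc n f k : (k <= n)%N -> (fps_trunc n f)`_k = f k.
Proof. by move=> le_kn; rewrite coef_poly ltnS le_kn. Qed.

Lemma fps_mul_trunc n f g k : (k <= n)%N ->
  fps_mul f g k = (fps_trunc n f * fps_trunc n g)`_k.
Proof.
move=> le_kn; rewrite coefM; apply: eq_bigr => i _.
rewrite !coef_fps_trunc ?(leq_trans (leq_subr _ _)) //.
exact: leq_trans (leq_ord i) le_kn.
Qed.

Lemma coef_mul_congr n (p p' q q' : {poly R}) :
    (forall k, (k <= n)%N -> p`_k = p'`_k) ->
    (forall k, (k <= n)%N -> q`_k = q'`_k) ->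
  (p * q)`_n = (p' * q')`_n.
Proof.
move=> eqp eqq; rewrite !coefM; apply: eq_bigr => i _.
by rewrite eqp ?leq_ord // eqq ?leq_subr.
Qed.

Fact fps_mulC : commutative fps_mul.
Proof. by move=> f g; apply: fpsP => n; rewrite !(@fps_mul_trunc n) // mulrC. Qed.

Fact fps_mulA : associative fps_mul.
Proof.
move=> f g h; apply: fpsP => n; rewrite !(@fps_mul_trunc n) //.
have tr u v k : (k <= n)%N ->
    (fps_trunc n (fps_mul u v))`_k = (fps_trunc n u * fps_trunc n v)`_k.
  by move=> le_kn; rewrite coef_fps_trunc // (fps_mul_trunc _ _ le_kn).
rewrite (@coef_mul_congr n _ (fps_trunc n f) _ (fps_trunc n g * fps_trunc n h)) //;
  last exact: tr.
by rewrite mulrA; apply: coef_mul_congr => // k /(tr f g) ->.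
Qed.

Fact fps_mul1 : left_id fps1 fps_mul.
Proof.
move=> f; apply: fpsP => n /=; rewrite big_ord_recl /= subn0 mul1r.
by rewrite big1 ?addr0 // => i _; rewrite mul0r.
Qed.

Fact fps_mulDl : left_distributive fps_mul fps_add.
Proof.
move=> f g h; apply: fpsP => n /=; rewrite -big_split /=.
by apply: eq_bigr => i _; rewrite mulrDl.
Qed.

Fact fps1_neq0 : fps1 != 0.
Proof. by apply/eqP => /(congr1 (@fpscoef R ^~ 0%N)) /eqP; rewrite /= oner_eq0. Qed.

HB.instance Definition _ := GRing.Zmodule_isComNzRing.Build (fps R)
  fps_mulA fps_mulC fps_mul1 fps_mulDl fps1_neq0.

Lemma fps_coef0 n : (0 : fps R) n = 0. Proof. by []. Qed.
Lemma fps_coef1 n : (1 : fps R) n = (n == 0%N)%:R. Proof. by []. Qed.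
Lemma fps_coefN f n : (- f) n = - f n. Proof. by []. Qed.
Lemma fps_coefD f g n : (f + g) n = f n + g n. Proof. by []. Qed.
Lemma fps_coefM f g n : (f * g) n = \sum_(i < n.+1) f i * g (n - i)%N.
Proof. by []. Qed.

Definition fpsX : fps R := Fps (fun n => (n == 1%N)%:R).

Lemma fps_coefXM f n : (fpsX * f) n = if n is k.+1 then f k else 0.
Proof.
rewrite fps_coefM big_ord_recl mul0r add0r; case: n => [|n]; first by rewrite big_ord0.
rewrite big_ord_recl mul1r big1 => [|i _]; last by rewrite mul0r.
by rewrite addr0 subSS subn0.
Qed.

Lemma fps_coefXnM f k n : (fpsX ^+ k * f) n = if (n < k)%N then 0 else f (n - k)%N.
Proof.
elim: k n => [|k IHk] n; first by rewrite expr0 mul1r subn0.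
by rewrite exprS -mulrA fps_coefXM; case: n => [|n] //; rewrite IHk ltnS subSS.
Qed.

End FpsRing.

Arguments fpsX {R}.

Section FpsField.
Variable F : fieldType.
Implicit Types f g : fps F.

Lemma fps_neq0P f : f != 0 ->
  exists n, f n != 0 /\ forall k, (k < n)%N -> f k = 0.
Proof.
move=> f_neq0; have exn : exists n, f n != 0.
  apply: contrapT => nex; case/eqP: f_neq0; apply: fpsP => n.
  by apply/eqP/negPn/negP => fn; apply: nex; exists n.
case: (ex_minnP exn) => n fn n_min; exists n; split=> // k lt_kn.
by apply/eqP/negPn/negP => /n_min; rewrite leqNgt lt_kn.
Qed.

Fixpoint fps_inv_seq f n : seq F :=
  if n is k.+1 then
    let s := fps_inv_seq f k in
    rcons s (if k == 0%N then (f 0%N)^-1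
             else - (f 0%N)^-1 * \sum_(i < k) f i.+1 * s`_(k - i.+1))
  else [::].

Definition fps_inv_ f := Fps (fun n => (fps_inv_seq f n.+1)`_n).

Lemma size_fps_inv_seq f n : size (fps_inv_seq f n) = n.
Proof. by elim: n => //= n IHn; rewrite size_rcons IHn. Qed.

Lemma nth_fps_inv_seq f n k : (k < n)%N -> (fps_inv_seq f n)`_k = fps_inv_ f k.
Proof.
elim: n => // n IHn; rewrite ltnS leq_eqVlt => /predU1P[-> //|lt_kn].
by rewrite [LHS]nth_rcons size_fps_inv_seq lt_kn IHn.
Qed.

Lemma fps_mul_inv f : f 0%N != 0 -> f * fps_inv_ f = 1.
Proof.
move=> f0; apply: fpsP => n; rewrite fps_coefM fps_coef1 big_ord_recl subn0.
rewrite [fpscoef (fps_inv_ f) n]/= nth_rcons size_fps_inv_seq ltnn eqxx.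
case: n => [|n]; first by rewrite big_ord0 addr0 divff.
rewrite mulrA mulrN divff // mulN1r; apply/eqP; rewrite addrC subr_eq0; apply/eqP.
by apply: eq_bigr => i _; rewrite nth_fps_inv_seq // ltn_subrL.
Qed.

Definition fps_unit : pred (fps F) := fun f => f 0%N != 0.
Definition fps_inv f := if fps_unit f then fps_inv_ f else f.

Fact fps_mulVf : {in fps_unit, left_inverse 1 fps_inv *%R}.
Proof.
by move=> f uf; rewrite /fps_inv ifT // mulrC fps_mul_inv.
Qed.

Fact fps_unitP f g : g * f = 1 -> fps_unit f.
Proof.
move=> /(congr1 (@fpscoef F ^~ 0%N)) /eqP /=; rewrite big_ord1.
by apply: contraTneq => ->; rewrite mulr0 eq_sym oner_eq0.
Qed.

Fact fps_inv_out : {in [predC fps_unit], fps_inv =1 id}.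
Proof. by move=> f nuf; rewrite /fps_inv ifN. Qed.

HB.instance Definition _ := GRing.ComNzRing_hasMulInverse.Build (fps F)
  fps_mulVf fps_unitP fps_inv_out.

Lemma fps_unitE f : (f \is a GRing.unit) = (f 0%N != 0).
Proof. by []. Qed.

Fact fps_integral : GRing.integral_domain_axiom (fps F).
Proof.
move=> f g fg0; rewrite -[_ || _]negbK negb_or; apply/negP.
case/andP=> /fps_neq0P[i [fi f_lt]] /fps_neq0P[j [gj g_lt]].
have /eqP := congr1 (@fpscoef F ^~ (i + j)%N) fg0.
have lt_i : (i < (i + j).+1)%N by rewrite ltnS leq_addr.
rewrite /= (bigD1 (Ordinal lt_i)) //= addKn big1 ?addr0 => [|k ne_ki].
  by rewrite mulf_eq0 (negPf fi) (negPf gj).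
have [/f_lt -> | le_ik] := ltnP k i; first by rewrite mul0r.
rewrite g_lt ?mulr0 // ltn_subLR ?leq_ord // ltn_add2r.
by rewrite ltn_neqAle le_ik andbT eq_sym.
Qed.

HB.instance Definition _ :=
  GRing.ComUnitRing_isIntegral.Build (fps F) fps_integral.

End FpsField.

(* F((x)) is the fraction field of F[[x]]; laurentP below recovers the usual  *)
(* description by series with finitely many negative exponents.               *)
Notation laurent F := {fraction (fps F)}.

Section LaurentTheory.
Variable F : fieldType.

Definition laurentX : laurent F := tofrac fpsX.

Lemma laurentX_neq0 : laurentX != 0.
Proof.
rewrite /laurentX tofrac_eq0; apply/eqP.
by move/(congr1 (@fpscoef F ^~ 1%N)) => /eqP; rewrite /= oner_eq0.
Qed.

Lemma laurent_fracP (z : laurent F) :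
  exists f g : fps F, g != 0 /\ z = tofrac f / tofrac g.
Proof.
elim/generic_quotient.quotW: z => r; exists (frac r).1, (frac r).2.
have dr := denom_ratioP r; split=> //; apply: (canRL (mulfK _)).
  by rewrite tofrac_eq0.
unlock tofrac; rewrite -[LHS]FracField.pi_mul; apply/generic_quotient.eqmodP.
rewrite /= FracField.equivfE /FracField.mulf !numden_Ratio ?mulr1 ?oner_eq0 //.
by rewrite mulrC.
Qed.

Lemma laurentP (z : laurent F) :
  exists (n : nat) (f : fps F), z = laurentX ^- n * tofrac f.
Proof.
have [f [g [/fps_neq0P[n [gn g_lt]] ->]]] := laurent_fracP z.
pose u : fps F := Fps (fun k => g (n + k)%N).
have Dg : g = fpsX ^+ n * u.
  apply: fpsP => k; rewrite fps_coefXnM /=.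
  by have [/g_lt|le_nk] := ltnP k n; rewrite ?subnKC.
have uu : u \is a GRing.unit by rewrite fps_unitE /= addn0.
exists n, (f * u^-1); rewrite Dg !rmorphM rmorphXn /= rmorphV //=.
by rewrite invfM mulrCA mulrA.
Qed.

End LaurentTheory.

Arguments laurentX {F}.

Local Open Scope classical_set_scope.

(* m s t = None stands for m_st = infinity. *)
Definition coxeter_matrix (S : finType) (m : S -> S -> option nat) : Prop :=
  [/\ forall s, m s s = Some 1%N,
      forall s t, m s t = m t s
    & forall s t k, s != t -> m s t = Some k -> (2 <= k)%N].

Definition coxeter_relations (S : finType) (m : S -> S -> option nat)
    (G : groupType) (f : S -> G) : Prop :=
  forall s t k, m s t = Some k -> ((f s * f t) ^+ k = 1)%g.

Definition generated_subgroup (G : groupType) (A : set G) : set G :=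
  smallest (fun H : set G => group_closed (mem H)) A.

(* W is presented by the generators gen s and the relations encoded by m: it  *)
(* is generated by them and universal among the groups satisfying the         *)
(* relations.                                                                 *)
Definition coxeter_system (S : finType) (m : S -> S -> option nat)
    (W : groupType) (gen : S -> W) : Prop :=
  [/\ coxeter_matrix m,
      coxeter_relations m gen,
      generated_subgroup (range gen) = [set: W]
    & forall (G : groupType) (f : S -> G), coxeter_relations m f ->
        exists phi : {multiplicative W -> G}, forall s, phi (gen s) = f s].

Section Growth.
Variables (S : finType) (W : groupType) (gen : S -> W).

(* As m s s = Some 1 makes each gen s an involution, words in the gen s alone *)
(* account for the inverses of the generators too.                            *)
Definition word_lengths (w : W) : set nat :=
  [set n | exists2 u : seq S, size u = n & (\prod_(s <- u) gen s)%g = w].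

Definition word_length (w : W) : nat :=
  xget 0%N [set n | word_lengths w n /\ forall k, word_lengths w k -> (n <= k)%N].

Definition parabolic (T : {set S}) : set W :=
  generated_subgroup (gen @` [set` T]).

Definition spherical (T : {set S}) : bool := `[< finite_set (parabolic T) >].

(* The value at t of the growth polynomial of W_T; meaningful for spherical T.*)
Definition growth_at (K : nzRingType) (T : {set S}) (t : K) : K :=
  \sum_(w \in parabolic T) t ^+ word_length w.

(* W(t^-1) as a power series in t^-1. In a Coxeter system each of these sets *)
(* is finite, since S is.                                                     *)
Definition growth_series : fps rat :=
  Fps (fun n => (#|` fset_set [set w : W | word_length w = n] |)%fset%:R).

End Growth.

(* Main.v *)
(* Let P_T(x) be the growth series of W_T and x = t^-1.  Every coset W_T w has  *)

(* The length facts behind this count come from one cocycle. By the universal property, W maps to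
   [sign_ext W], which yields [refl_sign]: the parity of the occurrences of a reflection r along a
   word of w. If it is odd, r does occur, and multiplying by r deletes a letter ([exchange]). This
   makes length additive over minimal coset representatives ([len_parabolic_mul]) and below an
   element with full descent set ([len_longest]). The first turns P_U / P_T into a counting series
   ([parabolic_series_mul]), to which inclusion-exclusion applies ([parabolic_series_sum]); the
   second evaluates the result as x^(len w0) or 0, whence [euler_sum]. Summing that over U with sign
   (-1)^|U| and exchanging the sums leaves only T = S, that is 1 / P_S. *)
(* a unique element v without left descents in T, and len (u v) = len u + len v *)
(* for u in W_T; so P_U / P_T counts the elements of W_U without left descents  *)
(* in T.  By inclusion-exclusion, P_U times the sum of (-1)^|T| / P_T over      *)
(* T in U counts the elements of W_U whose left descent set contains U.  There  *)
(* is one, the longest element w0, if W_U is finite, and none otherwise; as     *)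
(* len (u^-1 w0) = len w0 - len u, the sum is 1 / W_U(t) or 0 respectively.     *)
(* Moebius inversion over the subsets of S gives the theorem.                   *)
Require Import Defs.
From HB Require Import structures.
From mathcomp Require Import all_boot all_order all_algebra.
From mathcomp Require Import finmap boolp classical_sets functions cardinality fsbigop.
From mathcomp Require Import zify.

Set Implicit Arguments.
Unset Strict Implicit.
Unset Printing Implicit Defensive.

Import GRing.Theory.
Local Open Scope ring_scope.

(* The semidirect product of W and the functions W -> bool, on which W acts by  *)
(* conjugation.  A homomorphism from W to it lifting the identity of W is a     *)
(* cocycle; the one below records which reflections shorten a given element.    *)
Record sign_ext (W : Type) := SignExt { sign_base : W; sign_fun : W -> bool }.

HB.instance Definition _ (W : Type) := gen_eqMixin (sign_ext W).
HB.instance Definition _ (W : Type) := gen_choiceMixin (sign_ext W).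

Lemma sign_extP (W : Type) (x y : sign_ext W) :
  sign_base x = sign_base y -> sign_fun x =1 sign_fun y -> x = y.
Proof. by case: x y => [a f] [b g] /= -> /funext ->. Qed.

Section SignExtGroup.
Local Open Scope group_scope.
Variable W : groupType.
Implicit Types x y z : sign_ext W.

Definition sign_ext1 : sign_ext W := SignExt 1 (fun=> false).
Definition sign_ext_mul x y :=
  SignExt (sign_base x * sign_base y)
          (fun r => sign_fun x r (+) sign_fun y (r ^ sign_base x)).
Definition sign_ext_inv x :=
  SignExt (sign_base x)^-1 (fun r => sign_fun x (r ^ (sign_base x)^-1)).

Fact sign_ext_mulA : associative sign_ext_mul.
Proof.
by move=> x y z; apply: sign_extP => [|r] /=; rewrite ?mulgA // conjgM addbA.
Qed.
Fact sign_ext_mul1 : left_id sign_ext1 sign_ext_mul.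
Proof. by move=> x; apply: sign_extP => [|r] /=; rewrite ?mul1g ?conjg1. Qed.
Fact sign_ext_mulr1 : right_id sign_ext1 sign_ext_mul.
Proof. by move=> x; apply: sign_extP => [|r] /=; rewrite ?mulg1 ?addbF. Qed.
Fact sign_ext_mulV : left_inverse sign_ext1 sign_ext_inv sign_ext_mul.
Proof. by move=> x; apply: sign_extP => [|r] /=; rewrite ?mulVg ?addbb. Qed.
Fact sign_ext_mulrV : right_inverse sign_ext1 sign_ext_inv sign_ext_mul.
Proof.
by move=> x; apply: sign_extP => [|r] /=; rewrite ?mulgV // -conjgM mulgV conjg1 addbb.
Qed.

HB.instance Definition _ := isGroup.Build (sign_ext W)
  sign_ext_mulA sign_ext_mul1 sign_ext_mulr1 sign_ext_mulV sign_ext_mulrV.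

Lemma sign_base_mul x y : sign_base (x * y) = sign_base x * sign_base y.
Proof. by []. Qed.

Lemma sign_fun_mul x y r :
  sign_fun (x * y) r = sign_fun x r (+) sign_fun y (r ^ sign_base x).
Proof. by []. Qed.

Lemma sign_base_exp x n : sign_base (x ^+ n) = sign_base x ^+ n.
Proof. by elim: n => // n IHn; rewrite !expgS sign_base_mul IHn. Qed.

Lemma sign_fun_exp x n r :
  sign_fun (x ^+ n) r = \big[addb/false]_(j < n) sign_fun x (r ^ (sign_base x ^+ j)).
Proof.
elim: n r => [|n IHn] r; first by rewrite big_ord0.
rewrite expgS sign_fun_mul IHn big_ord_recl expg0 conjg1; congr addb.
by apply: eq_bigr => j _; rewrite -conjgM -expgS.
Qed.

End SignExtGroup.

Lemma big_addb_pairs (f : nat -> bool) k :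
  \big[addb/false]_(j < k) (f (2 * j)%N (+) f (2 * j).+1)
    = \big[addb/false]_(j < 2 * k) f j.
Proof.
elim: k => [|k IHk]; first by rewrite muln0 !big_ord0.
by rewrite mulnS !addSn add0n !big_ord_recr /= IHk addbA.
Qed.

(** * Words, parabolic subgroups and length in a Coxeter group *)

Section CoxeterGroup.
Local Open Scope group_scope.
Variables (S : finType) (m : S -> S -> option nat) (W : groupType) (gen : S -> W).
Hypothesis hW : coxeter_system m gen.
Implicit Types (s t : S) (T U : {set S}) (u v w r : W) (a b : seq S).

Local Notation pr a := (\prod_(s <- a) gen s).
Local Notation len := (word_length gen).

Lemma gen2 s : gen s * gen s = 1.
Proof. by case: hW => [[mss _ _] rel _ _]; rewrite -(rel s s 1%N). Qed.

Lemma genV s : (gen s)^-1 = gen s.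
Proof. exact/mulg1_eq/gen2. Qed.

Lemma genK s w : gen s * (gen s * w) = w.
Proof. by rewrite mulgA gen2 mul1g. Qed.

(* The reflections met along (s t)^k are c^j s for j < 2k with c = s t; they   *)
(* have period k, so each one is met an even number of times.                  *)
Lemma sign_ext_relations :
  coxeter_relations m (fun s => SignExt (gen s) (fun r => r == gen s)).
Proof.
case: hW => [_ rel _ _] s t k mst; have ck := rel s t k mst.
set x := SignExt _ _ * SignExt _ _; set c := gen s * gen t.
have xc : sign_base x = c by [].
have sc j : gen s * c ^- j = c ^+ j * gen s.
  elim: j => [|j IHj]; first by rewrite expg0 invg1 mul1g mulg1.
  rewrite {1}expgSr expgS invgM mulgA [c^-1]invgM !genV.
  by rewrite mulgA -/c -mulgA IHj mulgA.
have conj_eq w y z : (w ^ y == z) = (w == y * z * y^-1).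
  by rewrite (can2_eq (conjgK _) (conjgKV _)) /conjg invgK !mulgA.
apply: sign_extP => [|r]; first by rewrite sign_base_exp.
rewrite sign_fun_exp xc; pose e j := r == c ^+ j * gen s.
transitivity (\big[addb/false]_(j < k) (e (2 * j)%N (+) e (2 * j).+1)).
  apply: eq_bigr => j _; rewrite sign_fun_mul /= /e; congr (_ (+) _).
    by rewrite conj_eq -mulgA sc mulgA -expgnDr mul2n addnn.
  rewrite -conjgM conj_eq invgM genV sc mulgA -[_ * gen t]mulgA -expgSr.
  by rewrite -expgnDr addSn mul2n addnn.
rewrite big_addb_pairs mul2n -addnn big_split_ord /=.
rewrite -[RHS](addbb (\big[addb/false]_(j < k) e j)); congr addb.
by apply: eq_bigr => j _; rewrite /e expgnDr ck mul1g.
Qed.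

Lemma generated_group_closed (A : set W) :
  group_closed (mem (generated_subgroup A)).
Proof.
split; first by rewrite inE => H [[]]; rewrite inE.
move=> u v; rewrite !inE => Au Av H HA; case: (HA) => -[H1 HB] _.
by apply: set_mem; apply: HB; rewrite inE; [apply: Au | apply: Av].
Qed.

Lemma pr_rev a : pr (rev a) = (pr a)^-1.
Proof.
elim: a => [|s a IHa]; first by rewrite big_nil invg1.
by rewrite rev_cons -cats1 big_cat big_seq1 big_cons invgM genV IHa.
Qed.

(** As the generators are involutions, reversing a word inverts it, so the values of words over T
    already form a subgroup. *)
Lemma parabolicP T w :
  parabolic gen T w <-> exists2 a, all [in T] a & pr a = w.
Proof.
split=> [|[a]].
  move=> Tw; apply: (Tw [set w | exists2 a, all [in T] a & pr a = w]%classic).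
  split=> [|_ [s Ts <-]]; last by exists [:: s]; rewrite /= ?andbT ?big_seq1.
  split=> [|u v]; first by rewrite inE; exists [::]; rewrite // big_nil.
  rewrite !inE => -[a Ta <-] [b Tb <-]; exists (a ++ rev b).
    by rewrite all_cat Ta all_rev.
  by rewrite big_cat pr_rev.
elim: a w => [|s a IHa] w /=; first by move=> _ <-; rewrite big_nil => H [[]];
  rewrite inE.
case/andP=> Ts Ta <-; rewrite big_cons; apply: set_mem.
apply: (group_closedM (generated_group_closed _)); rewrite inE; last exact: IHa.
by move=> H [_]; apply; exists s.
Qed.

Lemma parabolic1 T : parabolic gen T 1.
Proof. by apply/parabolicP; exists [::]; rewrite ?big_nil. Qed.

Lemma parabolicM T u v :
  parabolic gen T u -> parabolic gen T v -> parabolic gen T (u * v).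
Proof.
case/parabolicP=> a Ta <- /parabolicP[b Tb <-]; apply/parabolicP.
by exists (a ++ b); rewrite ?all_cat ?Ta // big_cat.
Qed.

Lemma parabolicV T u : parabolic gen T u -> parabolic gen T u^-1.
Proof.
case/parabolicP=> a Ta <-; apply/parabolicP.
by exists (rev a); rewrite ?all_rev // pr_rev.
Qed.

Lemma parabolicS T U : T \subset U -> (parabolic gen T `<=` parabolic gen U)%classic.
Proof.
move=> /fintype.subsetP sTU w /parabolicP[a /allP Ta <-]; apply/parabolicP.
by exists a => //; apply/allP=> s /Ta; apply: sTU.
Qed.

Lemma parabolic_gen T s : s \in T -> parabolic gen T (gen s).
Proof.
by move=> Ts; apply/parabolicP; exists [:: s]; rewrite /= ?andbT ?big_seq1.
Qed.

Lemma parabolic_setT w : parabolic gen [set: S] w.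
Proof.
case: hW => _ _ genW _; have: [set: W]%classic w by [].
rewrite -genW; apply: sub_smallest2r => [|_ [s _ <-]].
  exact: generated_group_closed.
by exists s => //=; rewrite finset.in_setT.
Qed.

(** Every element is the value of some word, so the default of [xget] in [word_length] is never
    taken. *)
Lemma word_lengthP w :
  (exists2 a, size a = len w & pr a = w) /\ forall a, pr a = w -> (len w <= size a)%N.
Proof.
pose P n := `[< word_lengths gen w n >].
have exP : exists n, P n.
  have /parabolicP[a _ Da] := parabolic_setT w.
  by exists (size a); apply/asboolP; exists a.
pose Q : set nat := [set n | word_lengths gen w n /\
  forall k, word_lengths gen w k -> (n <= k)%N]%classic.
have [n [Wn n_min]] : exists n, Q n.
  case: (ex_minnP exP) => n /asboolP Pn n_min; exists n; split=> // k Wk.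
  exact/n_min/asboolP.
have [Wl l_min] : Q (len w) by apply: (xgetI _ (x := n)); split.
by split=> [|a Da]; [exact: Wl | apply: l_min; exists a].
Qed.

Lemma reduced_word w : exists2 a, size a = len w & pr a = w.
Proof. by case: (word_lengthP w). Qed.

Lemma leq_len a : (len (pr a) <= size a)%N.
Proof. by case: (word_lengthP (pr a)) => _; apply. Qed.

Lemma len1 : len 1 = 0%N.
Proof. by have := leq_len [::]; rewrite big_nil leqn0 => /eqP. Qed.

Lemma len_eq0 w : len w = 0%N -> w = 1.
Proof.
by have [a <- <-] := reduced_word w; move/size0nil=> ->; rewrite big_nil.
Qed.

Lemma len_mul u v : (len (u * v) <= len u + len v)%N.
Proof.
have [a <- <-] := reduced_word u; have [b <- <-] := reduced_word v.
by rewrite -big_cat -size_cat leq_len.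
Qed.

Lemma len_gen_mul s w : (len (gen s * w) <= (len w).+1)%N.
Proof.
by have [a <- <-] := reduced_word w; have := leq_len (s :: a); rewrite big_cons.
Qed.

(** * The reflection cocycle, exchange and descents *)

Lemma reflection_cocycle : exists eta : W -> W -> bool,
  (forall s r, eta (gen s) r = (r == gen s)) /\
  (forall u v r, eta (u * v) r = eta u r (+) eta v (r ^ u)).
Proof.
case: hW => _ _ _ /(_ _ _ sign_ext_relations)[phi phi_gen].
have base_phi w : sign_base (phi w) = w.
  have [a _ <-] := reduced_word w; elim: a => [|s a IHa].
    rewrite big_nil; apply: (mulgI (sign_base (phi 1))).
    by rewrite -sign_base_mul -gmulfM !mulg1.
  by rewrite big_cons gmulfM sign_base_mul IHa phi_gen.
exists (fun w => sign_fun (phi w)); split=> [s r | u v r]; first by rewrite phi_gen.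
by rewrite gmulfM sign_fun_mul base_phi.
Qed.

(* refl_sign w r is the parity of the number of i such that the reflection r is *)
(* s_1 ... s_i ... s_1, for any word s_1 ... s_n of w.                          *)
Definition refl_sign : W -> W -> bool := projT1 (cid reflection_cocycle).
Local Notation eta := refl_sign.

Lemma eta_gen s r : eta (gen s) r = (r == gen s).
Proof. by rewrite /eta; case: cid => f []. Qed.

Lemma eta_mul u v r : eta (u * v) r = eta u r (+) eta v (r ^ u).
Proof. by rewrite /eta; case: cid => f []. Qed.

(** Reading the word from the left, either r is the first letter, which is then dropped, or its
    conjugate by that letter is met in the tail. *)
Lemma exchange r a : eta (pr a) r ->
  exists b, [/\ (size b).+1 = size a, {subset b <= a} & pr b = r * pr a].
Proof.
elim: a r => [|s a IHa] r.
  by have := eta_mul 1 1 r; rewrite big_nil mulg1 conjg1 addbb => ->.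
rewrite big_cons eta_mul eta_gen; have [-> _|_ /=] := eqVneq.
  by exists a; split=> // [t|]; rewrite ?genK // inE orbC => ->.
case/IHa=> b [sz_b sba Db].
exists (s :: b); split=> [|t|]; first by rewrite /= sz_b.
  by rewrite !inE => /predU1P[->|/sba ->]; rewrite ?eqxx ?orbT.
by rewrite big_cons Db conjgE !mulgA mulgV mul1g.
Qed.

Lemma eta_len r w : eta w r -> (len (r * w) < len w)%N.
Proof.
have [a <- <-] := reduced_word w => /exchange[b [<- _ <-]].
by rewrite ltnS leq_len.
Qed.

(** For the converse, if the cocycle of w vanishes at s, that of s w does not, so s shortens s w to
    w. *)
Lemma eta_genE s w : eta w (gen s) = (len (gen s * w) < len w)%N.
Proof.
apply/idP/idP=> [/eta_len // | ]; apply: contraTT => eta0.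
rewrite -leqNgt ltnW // -{1}(genK s w) eta_len //.
by rewrite eta_mul eta_gen eqxx conjgE mulgA mulVg mul1g (negPf eta0).
Qed.

Definition left_descents w : {set S} := [set s | (len (gen s * w) < len w)%N].

Lemma eta_descent s w : eta w (gen s) = (s \in left_descents w).
Proof. by rewrite inE eta_genE. Qed.

Lemma len_ascent s w : s \notin left_descents w -> len (gen s * w) = (len w).+1.
Proof.
move=> Ds; apply/eqP; rewrite eqn_leq len_gen_mul /=.
rewrite -{1}(genK s w) -eta_genE eta_mul eta_gen eqxx.
by rewrite conjgE mulgA mulVg mul1g eta_descent (negPf Ds).
Qed.

(** Exchange only deletes letters, so shortening a word over T never leaves T; hence length in W_T
    agrees with length in W. *)
Lemma parabolic_reduced T u : parabolic gen T u ->
  exists a, [/\ all [in T] a, size a = len u & pr a = u].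
Proof.
case/parabolicP=> a; elim: a u => [|s a IHa] u /=.
  by move=> _ <-; exists [::]; rewrite big_nil len1.
case/andP=> Ts Ta <-; have [b [Tb sz_b Db]] := IHa _ Ta erefl.
rewrite big_cons -Db in sz_b *; have [Ds | Ds] := boolP (s \in left_descents (pr b)).
  rewrite -eta_descent in Ds; have [c [sz_c scb Dc]] := exchange Ds.
  exists c; split=> //; first by apply/allP=> t /scb; apply: (allP Tb).
  apply/eqP; rewrite eqn_leq -{2}Dc leq_len andbT -ltnS sz_c sz_b.
  by rewrite -{1}(genK s (pr b)) len_gen_mul.
by exists (s :: b); rewrite /= Ts Tb big_cons len_ascent // sz_b.
Qed.

(** * Cosets of parabolic subgroups and longest elements *)

(** Put the letters of a reduced word of u in front of v one by one. If s lengthens u' but shortens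
    u' v, the cocycle shows that the conjugate of s by u', an element of W_T, shortens v, against
    minimality. *)
Lemma len_mul_min T u v : parabolic gen T u ->
    (forall x, parabolic gen T x -> (len v <= len (x * v))%N) ->
  len (u * v) = (len u + len v)%N.
Proof.
case/parabolic_reduced=> a [Ta sz_a Du] v_min; rewrite -Du in sz_a *.
elim: a Ta sz_a {Du} => [|s a IHa] /=; first by rewrite big_nil mul1g len1.
case/andP=> Ts Ta; rewrite big_cons => sz_a.
have Da : size a = len (pr a).
  by apply/eqP; rewrite eqn_leq leq_len andbT -ltnS sz_a len_gen_mul.
have Ds : s \notin left_descents (pr a) by rewrite inE -sz_a Da -leqNgt.
rewrite -mulgA !len_ascent // ?IHa //.
rewrite -eta_descent eta_mul eta_descent (negPf Ds) /=.
apply/negP=> /eta_len; rewrite ltnNge v_min //.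
have Wa : parabolic gen T (pr a) by apply/parabolicP; exists a.
by rewrite conjgE; do !apply: parabolicM => //;
  [apply: parabolicV | apply: parabolic_gen].
Qed.

Lemma coset_min T w : exists2 u, parabolic gen T u &
  forall x, parabolic gen T x -> (len (u * w) <= len (x * (u * w)))%N.
Proof.
pose P n := `[< exists2 u, parabolic gen T u & len (u * w) = n >].
have exP : exists n, P n.
  by exists (len (1 * w)); apply/asboolP; exists 1 => //; apply: parabolic1.
case: (ex_minnP exP) => _ /asboolP[u Tu <-] u_min; exists u => // x Tx.
by apply: u_min; apply/asboolP; exists (x * u); [apply: parabolicM | rewrite mulgA].
Qed.

Definition coset_minimal T v := [disjoint T & left_descents v].

(** Local minimality is global: let u v be shortest in W_T v. If u is not 1, lengths add in v = u^-1
    (u v), so the first letter of a reduced word of u^-1 over T is a descent of v. *)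
Lemma coset_minimalP T v x : coset_minimal T v ->
  parabolic gen T x -> (len v <= len (x * v))%N.
Proof.
move=> disTv; have [u Tu u_min] := coset_min T v; move: x.
suff u1 : u = 1 by rewrite u1 mul1g in u_min.
have Tu' := parabolicV Tu; have [[|s a] [/= Ta sz_a Da]] := parabolic_reduced Tu'.
  by move: Da; rewrite big_nil => /esym/eqP; rewrite invg_eq1 => /eqP.
case/andP: Ta => Ts Ta; case/idP: (disjointFr disTv Ts).
rewrite inE -{2}(mulKg u v) (len_mul_min Tu' u_min) -sz_a.
rewrite -{1}(mulKg u v) mulgA -Da big_cons genK addSn ltnS.
by rewrite (leq_trans (len_mul _ _)) // leq_add2r leq_len.
Qed.

Lemma len_parabolic_mul T u v :
    parabolic gen T u -> coset_minimal T v ->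
  len (u * v) = (len u + len v)%N.
Proof. by move=> Tu disTv; apply: len_mul_min Tu _ => x; apply: coset_minimalP. Qed.

Lemma parabolic_decomp T w : exists u v,
  [/\ parabolic gen T u, coset_minimal T v & w = u * v].
Proof.
have [u Tu u_min] := coset_min T w; exists u^-1, (u * w).
split; [exact: parabolicV | | by rewrite mulKg].
rewrite /coset_minimal disjoint_subset; apply/fintype.subsetP => s Ts.
by rewrite !inE -leqNgt u_min //; apply: parabolic_gen.
Qed.

(** The element x = u'^-1 u takes v to v' and x^-1 takes v' back to v, each adding its own length;
    so x has length 0. *)
Lemma parabolic_decomp_uniq T u v u' v' :
    parabolic gen T u -> coset_minimal T v ->
    parabolic gen T u' -> coset_minimal T v' ->
  u * v = u' * v' -> u = u' /\ v = v'.
Proof.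
move=> Tu disTv Tu' disTv' eq_uv.
suff eq_u : u = u' by split=> //; apply: (mulgI u); rewrite {2}eq_u.
pose x := u'^-1 * u; have Tx : parabolic gen T x.
  by apply: parabolicM => //; apply: parabolicV.
have Dv' : x * v = v' by rewrite /x -mulgA eq_uv mulKg.
have Dv : x^-1 * v' = v by rewrite -Dv' mulKg.
have lx := len_parabolic_mul Tx disTv; rewrite Dv' in lx.
have lxV := len_parabolic_mul (parabolicV Tx) disTv'; rewrite Dv in lxV.
have /len_eq0 x1 : len x = 0%N by lia.
by apply/esym/(mulgI u'^-1); rewrite mulVg -x1.
Qed.

(** Such a w starts with a reduced word of every u in W_U. Inductively w = u' b with lengths adding;
    the next letter s shortens w but not u', so by the cocycle its conjugate by u' shortens b, to
    the remainder b' of w after s u'. *)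
Lemma len_longest U w u : U \subset left_descents w -> parabolic gen U u ->
  len w = (len u + len (u^-1 * w))%N.
Proof.
move=> /fintype.subsetP sUw /parabolic_reduced[a [Ta sz_a Du]]; rewrite -Du in sz_a *.
elim: a Ta sz_a {Du} => [|s a IHa] /=; first by rewrite big_nil invg1 mul1g len1.
case/andP=> Ts Ta; rewrite big_cons => sz_a.
have Da : size a = len (pr a).
  by apply/eqP; rewrite eqn_leq leq_len andbT -ltnS sz_a len_gen_mul.
have Ds : s \notin left_descents (pr a) by rewrite inE -sz_a Da -leqNgt.
have Dw := IHa Ta Da; set b := (pr a)^-1 * w in Dw.
have wE : w = pr a * b by rewrite mulVKg.
clearbody b.
have := sUw s Ts; rewrite -eta_descent {1}wE eta_mul eta_descent (negPf Ds) /=.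
move/eta_len; set b' := _ * b => lt_b'.
have -> : (gen s * pr a)^-1 * w = b'.
  by rewrite /b' wE conjgE invgM genV !mulgA.
have wb' : w = (gen s * pr a) * b' 
  by rewrite {1}wE /b' conjgE -!mulgA mulVKg genK.
have := len_mul (gen s * pr a) b'; rewrite -wb' len_ascent //; lia.
Qed.

Lemma finite_len n : finite_set [set w | (len w <= n)%N]%classic.
Proof.
apply: (@sub_finite_set _ _ (range (fun a : n.-bseq S => pr a))).
  move=> w /= le_wn; have [a sz_a <-] := reduced_word w.
  rewrite -sz_a in le_wn; by exists (Bseq le_wn).
exact/finite_image/finite_finset.
Qed.

End CoxeterGroup.

(** * Alternating sums over subsets and coefficients of power series *)

Lemma sum_signed_subsets (R : comNzRingType) (S : finType) (A : {set S}) :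
  \sum_(T : {set S} | T \subset A) (-1) ^+ #|T| = (A == finset.set0)%:R :> R.
Proof.
(* Expanding the product gives one term per subset of S, zero unless the subset lies in A; any i in
   A makes the factor -1 + 1 vanish. *)
pose F i : R := if i \in A then -1 else 0; transitivity (\prod_(i : S) (F i + 1)).
  rewrite bigA_distr [LHS]big_mkcond /=; apply: eq_bigr => T _.
  have [sTA | /subsetPn[i Ti nAi]] := boolP (T \subset A).
    rewrite -big_mkcond /= -prodr_const; apply: eq_bigr => i Ti.
    by rewrite /F (fintype.subsetP sTA).
  by rewrite (bigD1 i) //= Ti /F (negPf nAi) mul0r.
have [A0|/finset.set0Pn[i Ai]] := eqVneq A; last by rewrite (bigD1 i) //= /F Ai addNr mul0r.
by rewrite big1 // => i _; rewrite /F A0 finset.in_set0 add0r.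
Qed.

Lemma sum_signed_supersets (R : comNzRingType) (S : finType) (A : {set S}) :
  \sum_(T : {set S} | A \subset T) (-1) ^+ #|T| = (-1) ^+ #|A| *+ (A == [set: S]) :> R.
Proof.
rewrite (reindex_inj (inv_inj (@finset.setCK S))) /=.
transitivity ((-1) ^+ #|S| * \sum_(T : {set S} | T \subset ~: A) (-1) ^+ #|T| : R).
  rewrite mulr_sumr; apply: eq_big => T; first by rewrite finset.subsetC.
  move=> _; rewrite -[in RHS](cardsC T) exprD mulrAC -exprD addnn -mul2n.
  by rewrite exprM sqrrN !expr1n mul1r.
rewrite sum_signed_subsets -finset.setCT (inj_eq (inv_inj (@finset.setCK S))).
by have [->|] := eqVneq; rewrite ?mulr1 ?mulr0 // finset.cardsT.
Qed.

Lemma big_seq_only1 (R : Type) (idx : R) (op : Monoid.com_law idx) (I : eqType)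
    (x : I) (s : seq I) (F : I -> R) : uniq s -> x \in s ->
  {in s, forall y, y != x -> F y = idx} -> \big[op/idx]_(y <- s) F y = F x.
Proof.
move=> us sx F0; rewrite (bigD1_seq x) //= big1_seq ?Monoid.mulm1 // => y.
by case/andP=> neq_yx sy; apply: F0.
Qed.

Lemma fps_coef_sum (R : comNzRingType) (I : Type) (s : seq I) (P : pred I)
    (F : I -> fps R) n :
  (\sum_(i <- s | P i) F i) n = \sum_(i <- s | P i) F i n.
Proof. exact: (big_morph (fun f : fps R => f n)). Qed.

Lemma fps_coef_sign (R : comNzRingType) k (f : fps R) n :
  ((-1) ^+ k * f) n = (-1) ^+ k * f n.
Proof.
by rewrite -signr_odd -[in RHS]signr_odd; case: (odd k); rewrite ?mulN1r ?mul1r.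
Qed.

Lemma fps_coefXn (R : comNzRingType) k n : (fpsX ^+ k : fps R) n = (n == k)%:R.
Proof.
by rewrite -[fpsX ^+ k]mulr1 fps_coefXnM fps_coef1 subn_eq0; case: ltngtP.
Qed.

(** * Growth series of subsets of W and their identities *)

Section GrowthSeries.
Variables (S : finType) (m : S -> S -> option nat) (W : groupType) (gen : S -> W).
Hypothesis hW : coxeter_system m gen.
Implicit Types (s t : S) (T U : {set S}) (u v w : W) (A B C : set W).

Local Notation len := (word_length gen).
Local Notation sphere n := (fset_set [set w : W | len w = n]%classic).

Lemma in_sphere n w : (w \in sphere n) = (len w == n).
Proof.
rewrite in_fset_set; first by apply/idP/eqP; rewrite inE.
by apply: sub_finite_set (finite_len hW n) => v /= ->.
Qed.

Definition set_series A : fps rat :=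
  Fps (fun n => \sum_(w <- sphere n) `[< A w >]%:R).

Lemma growth_seriesE : growth_series gen = set_series setT.
Proof.
apply: fpsP => n /=; rewrite -sum1_size natr_sum; apply: eq_bigr => w _.
by rewrite asboolT.
Qed.

(** Unique factorization with additive lengths: both sides count the triples (u, v, u v) with u in
    A, v in B and len (u v) = n. *)
Lemma set_series_mul A B C :
    (forall u v, A u -> B v -> C (u * v)%g /\ len (u * v)%g = (len u + len v)%N) ->
    (forall w, C w -> exists u v, [/\ A u, B v & w = (u * v)%g]) ->
    (forall u v u' v', A u -> B v -> A u' -> B v' ->
       (u * v)%g = (u' * v')%g -> u = u' /\ v = v') ->
  set_series C = set_series A * set_series B.
Proof.
move=> ABC CAB AB_inj; apply: fpsP => n; rewrite fps_coefM /=.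
pose F u v w : rat := [&& `[< A u >], `[< B v >] & (u * v)%g == w]%:R.
transitivity (\sum_(w <- sphere n) \sum_(i < n.+1)
    \sum_(u <- sphere i) \sum_(v <- sphere (n - i)%N) F u v w); last first.
  rewrite exchange_big; apply: eq_bigr => i _ /=.
  rewrite exchange_big mulr_suml; apply: eq_big_seq => u; rewrite in_sphere => /eqP lu.
  rewrite exchange_big mulr_sumr; apply: eq_big_seq => v; rewrite in_sphere => /eqP lv.
  rewrite /F; case: asboolP => Au /=; last by rewrite mul0r big1.
  case: asboolP => Bv /=; last by rewrite mulr0 big1.
  have [_ luv] := ABC u v Au Bv.
  rewrite (@big_seq_only1 _ _ _ _ (u * v)%g) ?eqxx ?mulr1 ?fset_uniq //.
    by rewrite in_sphere luv lu lv subnKC // -ltnS.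
  by move=> w _; rewrite eq_sym => /negPf->.
apply: eq_big_seq => w; rewrite in_sphere => /eqP lw.
case: asboolP => [Cw | nCw]; last first.
  rewrite big1 // => i _; rewrite big1 // => u _; rewrite big1 // => v _.
  rewrite /F; case: and3P => // -[/asboolP Au /asboolP Bv /eqP uv].
  by case: nCw; rewrite -uv; case: (ABC u v Au Bv).
have [u [v [Au Bv Dw]]] := CAB w Cw; have [_ luv] := ABC u v Au Bv.
have F0 u' v' : (u' != u) || (v' != v) -> F u' v' w = 0.
  move=> neq; rewrite /F; case: and3P => // -[/asboolP Au' /asboolP Bv' /eqP].
  rewrite Dw => /AB_inj[] // eu ev.
  by rewrite eu ev !eqxx in neq.
have lt_u : (len u < n.+1)%N by rewrite ltnS -lw Dw luv leq_addr.
rewrite (@big_only1 _ _ _ _ (Ordinal lt_u)) //= => [|i neq_i _]; last first.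
  rewrite big_seq big1 // => u'; rewrite in_sphere => /eqP lu'.
  rewrite big1 // => v' _; apply: F0; rewrite -val_eqE /= -lu' in neq_i.
  by case: (eqVneq u' u) neq_i => // ->; rewrite eqxx.
rewrite (@big_seq_only1 _ _ _ _ u) ?fset_uniq ?in_sphere //; last first.
  by move=> u' _ neq; rewrite big1 // => v' _; rewrite F0 ?neq.
rewrite (@big_seq_only1 _ _ _ _ v) ?fset_uniq ?in_sphere //; last first.
- by move=> v' _ neq; rewrite F0 ?neq ?orbT.
- by rewrite -lw Dw luv addKn.
by rewrite /F !asboolT // Dw eqxx.
Qed.

Local Notation desc := (left_descents gen).

Lemma parabolic_series_mul T U : T \subset U ->
  set_series (parabolic gen U) = set_series (parabolic gen T) *
    set_series [set v | parabolic gen U v /\ coset_minimal gen T v]%classic.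
Proof.
move=> sTU; have TU := parabolicS hW sTU.
apply: set_series_mul => [u v Tu [Uv dv]|w Uw|u v u' v' Tu [_ dv] Tu' [_ dv']].
- by split; [apply: (parabolicM hW) => //; apply: TU | apply: (len_parabolic_mul hW Tu)].
- have [u [v [Tu dv Dw]]] := parabolic_decomp hW T w; exists u, v; split=> //.
  split=> //; have -> : v = (u^-1 * w)%g by rewrite Dw mulKg.
  by apply: (parabolicM hW) => //; apply: (parabolicV hW); apply: TU.
exact: (parabolic_decomp_uniq hW Tu dv Tu' dv').
Qed.

Lemma parabolic_series_unit T : set_series (parabolic gen T) \is a GRing.unit.
Proof.
rewrite fps_unitE /= (@big_seq_only1 _ _ _ _ 1%g) ?fset_uniq //.
- by rewrite asboolT //; apply: (parabolic1 hW).
- by rewrite in_sphere (len1 hW).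
by move=> w; rewrite in_sphere => /eqP/(len_eq0 hW) -> /eqP.
Qed.

(** An element w of W_U is counted for exactly the T in U that avoid its descents, so its total
    weight is the alternating sum over subsets of U minus [desc w], nonzero only if that difference
    is empty. *)
Lemma parabolic_series_sum U :
  set_series (parabolic gen U) *
    (\sum_(T : {set S} | T \subset U) (-1) ^+ #|T| / set_series (parabolic gen T))
  = set_series [set w | parabolic gen U w /\ U \subset desc w]%classic.
Proof.
rewrite mulr_sumr; apply: fpsP => n; rewrite fps_coef_sum.
transitivity (\sum_(T : {set S} | T \subset U) (-1) ^+ #|T| *
   set_series [set v | parabolic gen U v /\ coset_minimal gen T v]%classic n).
  apply: eq_bigr => T sTU; rewrite -fps_coef_sign mulrCA; congr (fpscoef (_ * _) n).
  by rewrite (parabolic_series_mul sTU) mulrAC divrr ?mul1r ?parabolic_series_unit.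
under eq_bigr => T _ do rewrite /= mulr_sumr.
rewrite exchange_big /=; apply: eq_bigr => w _.
transitivity (\sum_(T : {set S} | T \subset U :\: desc w) (-1) ^+ #|T| *
   `[< parabolic gen U w >]%:R : rat).
  rewrite [RHS]big_mkcond [LHS]big_mkcond; apply: eq_bigr => T _.
  rewrite subsetD -/(coset_minimal gen T w); case: (T \subset U) => //=.
  by rewrite asbool_and asboolb; case: coset_minimal; rewrite ?andbT ?andbF ?mulr0.
rewrite -mulr_suml sum_signed_subsets finset.setD_eq0 mulrC -natrM mulnb.
by rewrite asbool_and asboolb.
Qed.

Lemma longest_spherical U w : parabolic gen U w -> U \subset desc w ->
  spherical gen U.
Proof.
move=> _ dw; apply/asboolP; apply: sub_finite_set (finite_len hW (len w)) => u Uu /=.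
by rewrite (len_longest hW dw Uu) leq_addr.
Qed.

(** An element of maximal length in the finite group W_U has no ascent in U. *)
Lemma spherical_longest U : spherical gen U ->
  exists2 w, parabolic gen U w & U \subset desc w.
Proof.
move=> /asboolP finU; pose P n := `[< exists2 w, parabolic gen U w & len w = n >].
have exP : exists n, P n.
  by exists (len 1%g); apply/asboolP; exists 1%g => //; apply: (parabolic1 hW).
have ubP n : P n -> (n <= \max_(w <- fset_set (parabolic gen U)) len w)%N.
  by case/asboolP=> w Uw <-; apply: leq_bigmax_seq => //; rewrite in_fset_set ?inE.
case: (ex_maxnP exP ubP) => _ /asboolP[w Uw <-] w_max; exists w => //.
apply/fintype.subsetP=> s Us; apply/negPn/negP => /(len_ascent hW) lsw.
have /w_max : P (len (gen s * w)%g); last by rewrite lsw ltnn.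
apply/asboolP; exists (gen s * w)%g => //.
by apply: (parabolicM hW) => //; apply: (parabolic_gen hW).
Qed.

Lemma longest_uniq U w w' : parabolic gen U w -> U \subset desc w ->
  parabolic gen U w' -> U \subset desc w' -> w = w'.
Proof.
move=> Uw dw Uw' dw'; have l1 := len_longest hW dw Uw'.
have l2 := len_longest hW dw' Uw.
have /(len_eq0 hW) e1 : len (w'^-1 * w)%g = 0%N by lia.
by apply: (mulgI w'^-1%g); rewrite mulVg.
Qed.

Lemma longest_series U w : parabolic gen U w -> U \subset desc w ->
  set_series [set w | parabolic gen U w /\ U \subset desc w]%classic = fpsX ^+ len w.
Proof.
move=> Uw dw; apply: fpsP => n; rewrite fps_coefXn /=.
have [->|neq] := eqVneq n.
  rewrite (@big_seq_only1 _ _ _ _ w) ?fset_uniq ?in_sphere ?asboolT //.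
  move=> w' _ /eqP neq; rewrite asboolF // => -[Uw' dw']; apply: neq.
  exact: longest_uniq Uw dw.
rewrite big_seq big1 // => w'; rewrite in_sphere => /eqP lw'; rewrite asboolF //.
move=> [Uw' dw']; case/eqP: neq; rewrite -lw'; congr (len _).
exact: longest_uniq Uw dw.
Qed.

(** Summing by elements instead of by lengths makes the series a finite sum, which can be compared
    term by term with [growth_at] in the Laurent field. *)
Lemma spherical_series U : spherical gen U ->
  set_series (parabolic gen U)
    = \sum_(w <- fset_set (parabolic gen U)) fpsX ^+ len w.
Proof.
move=> /asboolP finU; apply: fpsP => n; rewrite fps_coef_sum /=.
under [RHS]eq_bigr => w _ do rewrite fps_coefXn.
transitivity (\sum_(w <- sphere n | w \in fset_set (parabolic gen U)) 1 : rat).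
  rewrite [RHS]big_mkcond; apply: eq_bigr => w _; rewrite in_fset_set //.
  by rewrite -[w \in parabolic gen U]/`[< _ >]; case: asbool.
transitivity (\sum_(w <- fset_set (parabolic gen U) | w \in sphere n) 1 : rat); last first.
  by rewrite big_mkcond; apply: eq_bigr => w _; rewrite in_sphere eq_sym; case: eqP.
rewrite -[LHS]big_filter -[RHS]big_filter; apply: perm_big; apply: uniq_perm.
- by rewrite filter_uniq ?fset_uniq.
- by rewrite filter_uniq ?fset_uniq.
by move=> w; rewrite !mem_filter andbC.
Qed.

(* Left division by the longest element permutes W_U and reverses lengths. *)
Lemma growth_at_longest U w : parabolic gen U w -> U \subset desc w ->
  growth_at gen U (laurentX^-1 : laurent rat)
    = tofrac (set_series (parabolic gen U)) / laurentX ^+ len w.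
Proof.
move=> Uw dw; have sphU := longest_spherical Uw dw; have finU := asboolP _ sphU.
rewrite spherical_series // rmorph_sum mulr_suml /growth_at -fsbig_finite //.
rewrite (@reindex_fsbig _ _ _ _ _ (fun u => u^-1 * w)%g (parabolic gen U)).
  rewrite !fsbig_finite //; apply: eq_big_seq => u; rewrite in_fset_set // inE => Uu.
  have lw := len_longest hW dw Uu; rewrite lw rmorphXn /= -/laurentX exprD exprVn.
  by rewrite invfM mulrA divff ?mul1r // expf_neq0 // laurentX_neq0.
split=> [u Uu | u v _ _ | u Uu] /=.
- by apply: (parabolicM hW) => //; apply: (parabolicV hW).
- by move/mulIg/invg_inj.
exists (w * u^-1)%g; first by apply: (parabolicM hW) => //; apply: (parabolicV hW).
by rewrite invgM invgK mulgVK.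
Qed.

(** The sum is the series of elements with descents containing U, divided by P_U. That numerator is
    x^(len w0) when W_U is finite, giving 1 / W_U(t), and is empty otherwise. *)
Lemma euler_sum U :
  \sum_(T : {set S} | T \subset U)
     (-1) ^+ #|T| / tofrac (set_series (parabolic gen T))
  = if spherical gen U then (growth_at gen U (laurentX^-1 : laurent rat))^-1 else 0.
Proof.
set lhs := LHS; have PU : tofrac (set_series (parabolic gen U)) != 0 :> laurent rat.
  by rewrite tofrac_eq0; apply: contraTneq (parabolic_series_unit U) => ->; rewrite unitr0.
have -> : lhs = tofrac (set_series [set w | parabolic gen U w /\ U \subset desc w]%classic)
    / tofrac (set_series (parabolic gen U)).
  rewrite -parabolic_series_sum rmorphM /= mulrAC divff // mul1r rmorph_sum.
  apply: eq_bigr => T _; rewrite rmorphM rmorphV ?parabolic_series_unit //.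
  by rewrite /= rmorphXn rmorphN rmorph1.
case: ifPn => [/spherical_longest[w Uw dw] | nsphU].
  by rewrite (longest_series Uw dw) (growth_at_longest Uw dw) invfM invrK rmorphXn mulrC.
suff -> : set_series [set w | parabolic gen U w /\ U \subset desc w]%classic = 0.
  by rewrite rmorph0 mul0r.
apply: fpsP => n /=; rewrite big1 // => w _; rewrite asboolF // => -[Uw dw].
by rewrite (longest_spherical Uw dw) in nsphU.
Qed.

End GrowthSeries.

Theorem mainTheorem4 (S : finType) (m : S -> S -> option nat)
    (W : groupType) (gen : S -> W) (hW : coxeter_system m gen) :
  \sum_(T : {set S} | spherical gen T)
     (-1) ^+ #|T| / growth_at gen T (laurentX^-1 : laurent rat)
  = (tofrac (growth_series gen))^-1.
Proof.
pose P T : laurent rat := tofrac (set_series gen (parabolic gen T)).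
(* [euler_sum] extends the sum to all U, the infinite W_U contributing 0. For fixed T, the signs of
   the U containing T then cancel unless T = S, where the two factors (-1)^|S| multiply to 1. *)
transitivity (\sum_(U : {set S}) \sum_(T : {set S} | T \subset U)
    (-1) ^+ #|U| * ((-1) ^+ #|T| / P T)).
  rewrite big_mkcond; apply: eq_bigr => U _; rewrite -mulr_sumr (euler_sum hW).
  by case: ifP; rewrite ?mulr0.
rewrite (exchange_big_dep predT) //=.
under eq_bigr => T _ do rewrite -mulr_suml sum_signed_supersets.
rewrite (bigD1 [set: S]) //= big1 => [|T /negPf->]; last by rewrite mulr0n mul0r.
rewrite eqxx mulr1n addr0 mulrA -exprD addnn -mul2n exprM sqrrN !expr1n mul1r.
congr (tofrac _)^-1; rewrite growth_seriesE; congr set_series.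
by apply/seteqP; split=> // w _; apply: (parabolic_setT hW).
Qed.
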